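(* Let $G$ be a finite group. (1) If $\mathcal I(G)\cong\mathcal I(Q_8)$, then $G\cong Q_8$. (2) If $\mathcal I(G)\cong\mathcal I(M_8)$, then $G\cong M_8$. (3) If $\mathcal I(G)\cong\mathcal I(\mathbb Z_9\rtimes\mathbb Z_2)$, then $G\cong\mathbb Z_9\rtimes\mathbb Z_2$.
   Context: For a finite group $G$, the inclusion graph of subgroups $\mathcal I(G)$ is the simple graph whose vertices are the proper subgroups of $G$, where ''proper'' means different from both the trivial subgroup and $G$ itself; two distinct vertices $H,K$ are adjacent if and only if $H\subset K$ or $K\subset H$. Isomorphism of inclusion graphs means graph isomorphism. $Q_8$ is the quaternion group of order 8; $M_8=\langle a,b\mid a^4=b^2=1,\ ab=ba^{-1}\rangle$; $\mathbb Z_9\rtimes\mathbb Z_2=\langle a,b\mid a^9=b^2=1,\ bab^{-1}=a^i\rangle$ where $i$ has multiplicative order $2$ modulo $9$. *)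

(* Defs.v *)
From HB Require Import structures.
From mathcomp Require Import all_boot all_order all_algebra.
From mathcomp Require Import all_fingroup all_solvable.

Set Implicit Arguments.
Unset Strict Implicit.
Unset Printing Implicit Defensive.

Import GroupScope.

Definition graph_iso (V W : finType) (e : rel V) (f : rel W) : Prop :=
  exists2 h : V -> W, bijective h & forall x y : V, f (h x) (h y) = e x y.

(* "Proper" here also excludes the trivial subgroup. *)
Definition proper_subgroup (gT : finGroupType) (G : {group gT}) :
    pred {group gT} :=
  fun H => [&& H \subset G, H :!=: 1 & H :!=: G].

Definition proper_subgroups (gT : finGroupType) (G : {group gT}) : finType :=
  {H : {group gT} | proper_subgroup G H}.

Definition inclusion_graph (gT : finGroupType) (G : {group gT}) :
    rel (proper_subgroups G) :=
  fun H K =>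
    (H != K) && ((val H \subset val K) || (val K \subset val H)).

Arguments inclusion_graph {gT} G%_G.

(* \isog Grp identifies a finite group with the group presented whenever the
   latter is finite, as it is in both cases below. *)
Definition is_M8 (gT : finGroupType) (M : {group gT}) : Prop :=
  M \isog Grp (a : b : a ^+ 4, b ^+ 2, a * b = b * a^-1).

(* The intended group when i has multiplicative order 2 modulo 9. *)
Definition is_Z9_rtimes_Z2 (i : nat) (gT : finGroupType) (M : {group gT}) :
    Prop :=
  M \isog Grp (a : b : a ^+ 9, b ^+ 2, b * a * b^-1 = a ^+ i).

Definition has_order2_mod9 (i : nat) : Prop :=
  (2.-primitive_root (i%:R : 'Z_9))%R.

(* The two presentations are realized by dihedral groups, so the hypotheses
   is_M8 M and is_Z9_rtimes_Z2 i M are satisfiable. *)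
Lemma is_M8_dihedral : is_M8 'D_8.
Proof.
move=> rT H; rewrite (@Grp_dihedral 4) //.
apply/existsP/existsP=> [] [[x y]] /eqP[defH x4 y2 xy]; exists (x, y);
  rewrite /= !xpair_eqE defH x4 y2 !eqxx /=.
  by rewrite -xy -conjgC.
by rewrite conjgE xy mulKg.
Qed.

Lemma has_order2_mod9E i : has_order2_mod9 i -> i = 8 %[mod 9].
Proof.
rewrite /has_order2_mod9 -(Zp_nat_mod (isT : 1 < 9)).
have := ltn_pmod i (isT : 0 < 9); move: (i %% 9) => k lt_k9 prim_k.
have /eqP := prim_expr_order prim_k; have := prim_order_dvd prim_k 1.
by move: lt_k9 {prim_k}; do 9?[case: k => [|k]].
Qed.

Lemma is_Z9_rtimes_Z2_dihedral i :
  has_order2_mod9 i -> is_Z9_rtimes_Z2 i 'D_18.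
Proof.
move=> /has_order2_mod9E i8 rT H; rewrite (@Grp_dihedral 9) //.
have xi (x : rT) : x ^+ 9 = 1 -> x ^+ i = x^-1.
  move=> x9; rewrite -(expg_mod _ x9) i8 expg_mod //.
  by apply: (mulgI x); rewrite -expgS x9 mulgV.
have yV (y : rT) : y ^+ 2 = 1 -> y^-1 = y.
  by move=> y2; apply: (mulgI y); rewrite mulgV -y2.
apply/existsP/existsP=> [] [[x y]] /eqP[defH x9 y2 xy]; exists (x, y);
  rewrite /= !xpair_eqE defH x9 y2 !eqxx /=.
  by rewrite xi // -xy conjgE yV // mulgA.
by rewrite conjgE mulgA (yV y) // -(xi x) // -xy (yV y).
Qed.

(* Main.v *)
Require Import Defs.
From HB Require Import structures.
From mathcomp Require Import all_boot all_order all_algebra.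
From mathcomp Require Import all_fingroup all_solvable.

Set Implicit Arguments.
Unset Strict Implicit.
Unset Printing Implicit Defensive.

Import GroupScope.

(** The inclusion graph forgets which of two neighbours is the larger one, so
    the proof consists in recovering the orientation, and then the orders of
    the subgroups, from the shape of the graph.

    The graph of [Q_8] is a star: its centre is the subgroup of order 2 and its
    three ends are the cyclic subgroups of order 4. If the graph of a group [G]
    is a star with at least two ends, no end can lie below the centre: the
    centre would then be the only maximal subgroup of [G], so that [G] would be
    a cyclic p-group, whose subgroups form a chain ([star_ends_above]). So the
    centre is the only minimal subgroup, every end is a cyclic maximal subgroup
    of order [q ^ 2], and [G] is a noncyclic q-group of order [q ^ 3] with a
    single subgroup of order [q]; such groups are quaternion
    ([star_quaternion]).

    [M_8] and [Z_9 ><| Z_2] are the dihedral groups of order [2 p ^ 2], for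
    [p = 2] and [p = 3]. For prime [p] the graph of this dihedral group is a
    tree ([dihedral_rooted_tree]): the root [z] is the subgroup of rotations of
    order [p], its children are the rotation group [c], which is an end of the
    tree, and the [p] dihedral subgroups of order [2 p], each of which carries
    as its leaves the [p] subgroups generated by its reflections.

    Suppose now that the graph of [G] is such a tree. The root must be below
    its children, for otherwise the leaves would be maximal subgroups too many
    and too large for [G] ([root_above_absurd]). Then [z] and [c] are normal in
    [G], [c] is cyclic of order [#|z| ^ 2], each leaf [x] has prime order, the
    child of [z] that carries [x] is [z * x], and [G = c * x]. Counting the
    leaves of one child gives [#|z| = p], and also that the order of the leaves
    is [p] or divides [p - 1] ([leaves_count]). If it is [p], then [G] is a
    p-group generated by elements of order [p], which for odd [p] contradicts
    the presence of [c]. So for [p <= 3] the leaves have order 2, and since [G]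
    is not abelian a generator of a leaf acts on [c] by inversion: [G] is
    dihedral ([rooted_tree_dihedral]). *)

(** * Neighbours in the inclusion graph *)

(** The inclusion graph has vertices in a subtype that depends on [G]. These
    neighbourhoods are sets of groups, so that joins, intersections and
    conjugates of vertices need no cast. *)
Definition neighbours (gT : finGroupType) (G H : {group gT}) :
    {set {group gT}} :=
  [set K : {group gT} | [&& proper_subgroup G K, H != K
                          & (H \subset K) || (K \subset H)]].

Lemma neighboursC (gT : finGroupType) (G H K : {group gT}) :
  proper_subgroup G H -> K \in neighbours G H -> H \in neighbours G K.
Proof. by move=> pH; rewrite !inE pH eq_sym orbC => /and3P[_ -> ->]. Qed.

Lemma neighbours_proper (gT : finGroupType) (G H K : {group gT}) :
  K \in neighbours G H -> proper_subgroup G K.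
Proof. by rewrite inE => /and3P[]. Qed.

Lemma neighboursP (gT : finGroupType) (G H K : {group gT}) :
  reflect (proper_subgroup G K /\ (H \proper K \/ K \proper H))
          (K \in neighbours G H).
Proof.
rewrite inE; apply: (iffP and3P) => [[-> nHK sHK] | [-> sHK]].
  split=> //; have [sHK' | sKH] := orP sHK; [left | right].
    by rewrite properEneq sHK' andbT.
  by rewrite properEneq sKH andbT eq_sym.
split=> //; last by case: sHK => /proper_sub->; rewrite ?orbT.
by apply: contraTneq isT => eHK; case: sHK; rewrite eHK properxx.
Qed.

Lemma upper_neighbour (gT : finGroupType) (G H K : {group gT}) :
    proper_subgroup G H -> H \proper K -> K \subset G -> K :!=: G ->
  K \in neighbours G H.
Proof.
move=> pH HK KG nKG; apply/neighboursP; split; last by left.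
rewrite /proper_subgroup KG nKG andbT; apply: contraTneq HK => ->.
by rewrite properE sub1G andbF.
Qed.

Lemma lower_neighbour (gT : finGroupType) (G H K : {group gT}) :
    proper_subgroup G H -> K \proper H -> K :!=: 1 ->
  K \in neighbours G H.
Proof.
case/and3P=> HG _ nHG KH K1; apply/neighboursP; split; last by right.
rewrite /proper_subgroup K1 (subset_trans (proper_sub KH)) //=.
by apply: contraTneq KH => ->; rewrite properE HG andbF.
Qed.

Lemma conj_proper (gT : finGroupType) (G H : {group gT}) g : g \in G ->
  proper_subgroup G H -> proper_subgroup G (H :^ g)%G.
Proof.
move=> Gg /and3P[HG H1 nHG]; apply/and3P; split.
- by rewrite /= -(conjGid Gg) conjSg.
- by rewrite /= conjsg_eq1.
by apply: contraNneq nHG => /= e; rewrite eqEcard HG -(cardJg H g) e leqnn.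
Qed.

Lemma conj_neighbour (gT : finGroupType) (G H K : {group gT}) g : g \in G ->
    proper_subgroup G K -> H \proper K ->
  (K :^ g)%G \in neighbours G (H :^ g)%G.
Proof.
move=> Gg pK HK; apply/neighboursP; split; first exact: conj_proper.
by left; rewrite /= properJ.
Qed.

(** By Cauchy, a group of composite order has a nontrivial proper subgroup, and
    that subgroup would be a neighbour from below. *)
Lemma minimal_vertex_prime (gT : finGroupType) (G H : {group gT}) :
    proper_subgroup G H -> (forall K, K \in neighbours G H -> ~~ (K \proper H)) ->
  prime #|H|.
Proof.
move=> pH minH; have /and3P[_ H1 _] := pH.
have r_pr : prime (pdiv #|H|) by rewrite pdiv_prime ?cardG_gt1.
have [x Hx ox] := Cauchy r_pr (pdiv_dvd _).
have xH : <[x]> \subset H by rewrite cycle_subG.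
have x1 : <[x]>%G :!=: 1 by rewrite -cardG_gt1 -orderE ox prime_gt1.
suff <- : <[x]> = H by rewrite -orderE ox.
apply: contraTeq isT => nxH.
have xpH : <[x]>%G \proper H by rewrite properEneq nxH.
by have := minH _ (lower_neighbour pH xpH x1); rewrite xpH.
Qed.

(** A graph isomorphism, read on groups. The map goes from [M] to [G] because
    properties of the graph of the known group [M] are to be transported to [G];
    its value outside the vertices is arbitrary. *)
Lemma graph_iso_groups (gT mT : finGroupType) (G : {group gT})
    (M : {group mT}) :
  graph_iso (inclusion_graph G) (inclusion_graph M) ->
  exists k : {group mT} -> {group gT},
    [/\ {in proper_subgroup M &, injective k},
        forall K, proper_subgroup M K -> proper_subgroup G (k K),
        forall H, proper_subgroup G H ->
          exists2 K, proper_subgroup M K & H = k K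
      & forall K, proper_subgroup M K ->
          neighbours G (k K) = k @: neighbours M K].
Proof.
case=> h [g hK gK] ehh.
pose k (K : {group mT}) : {group gT} :=
  if insub K is Some u then val (g (u : proper_subgroups M)) else 1%G.
have kE (u : proper_subgroups M) : k (val u) = val (g u) by rewrite /k valK.
have vP K : proper_subgroup M K -> exists u : proper_subgroups M, K = val u.
  by move=> pK; exists (Sub K pK : proper_subgroups M); rewrite SubK.
have kP K : proper_subgroup M K -> proper_subgroup G (k K).
  by case/vP=> u ->; rewrite kE; apply: (valP (g u)).
have kS H : proper_subgroup G H -> exists2 K, proper_subgroup M K & H = k K.
  move=> pH; pose u : proper_subgroups G := Sub H pH.
  exists (val (h u)); first exact: (valP (h u)).
  by rewrite kE hK /u SubK.
have kN K L : proper_subgroup M K -> proper_subgroup M L ->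
    (k L \in neighbours G (k K)) = (L \in neighbours M K).
  move=> pK pL; rewrite !inE pL kP //=.
  case/vP: pK => u ->; case/vP: pL => v ->; rewrite !kE.
  by have := ehh (g u) (g v); rewrite !gK /inclusion_graph => ->.
exists k; split=> // [K L /vP[u ->] /vP[v ->] | K pK].
  by rewrite !kE => /val_inj/(can_inj gK)->.
apply/setP=> H; apply/idP/imsetP=> [NH | [L NL ->]].
  have [L pL eH] := kS H (neighbours_proper NH).
  by exists L => //; rewrite -kN // -eH.
by rewrite kN // (neighbours_proper NL).
Qed.

(** * End vertices *)

(** A vertex [m] whose only neighbour [s] is contained in it: [m] is a maximal
    subgroup, and [s] is its only nontrivial proper subgroup. *)

Section EndVertex.
Variables (gT : finGroupType) (G m s : {group gT}).
Hypotheses (pm : proper_subgroup G m) (Nm : neighbours G m = [set s]).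
Hypothesis sm : s \proper m.

Lemma end_vertex_above (K : {group gT}) :
  m \subset K -> K \subset G -> K :!=: m -> K :=: G.
Proof.
move=> mK KG nKm; apply: contraTeq sm => nKG.
have mpK : m \proper K by rewrite properEneq eq_sym nKm.
have := upper_neighbour pm mpK KG nKG.
by rewrite Nm inE => /eqP <-; rewrite properE mK andbF.
Qed.

Lemma end_vertex_below (K : {group gT}) :
  K \subset m -> K :!=: 1 -> K = m \/ K = s.
Proof.
move=> Km K1; case: (eqVneq K m) => [|nKm]; [by left | right].
apply/set1P; rewrite -Nm; apply: lower_neighbour => //.
by rewrite properEneq Km andbT; apply: contra_neq nKm => /group_inj.
Qed.

(** Conjugation in [m] preserves the orders of the subgroups of [m]. *)
Lemma end_vertex_norm : proper_subgroup G s -> m \subset 'N(s).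
Proof.
case/and3P=> sG s1 _; apply/subsetP=> x mx; rewrite inE.
have sxm : s :^ x \subset m by rewrite -(conjGid mx) conjSg proper_sub.
have [||/= sx|/(congr1 val)/= ->//] := @end_vertex_below (s :^ x)%G.
- exact: sxm.
- by rewrite conjsg_eq1.
by have := proper_card sm; rewrite -sx /= cardJg ltnn.
Qed.
End EndVertex.

(** Any element [g] of [c] outside [z] generates [c]. Its power [g ^+ #|z|]
    generates neither [c] nor the trivial group, so it generates [z]. *)
Lemma end_vertex_cyclic (gT : finGroupType) (G c z : {group gT}) :
    proper_subgroup G c -> neighbours G c = [set z] -> z \proper c ->
  prime #|z| -> cyclic c /\ #|c| = (#|z| ^ 2)%N.
Proof.
move=> pc Nc c_above q_pr; have /andP[zltc nzc] := c_above.
have [g cg nzg] : exists2 g, g \in c & g \notin z by apply/subsetPn.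
have sub (K : {group gT}) : K \subset c -> K :!=: 1 -> K = c \/ K = z.
  by move=> Kc; apply: (end_vertex_below pc Nc Kc).
have defc : c :=: <[g]>.
  have [||e|e] := sub <[g]>%G; rewrite ?cycle_subG //.
  - by apply: contraNneq nzg => /= e; rewrite -cycle_subG e sub1G.
  - by rewrite -e.
  by case/negP: nzg; rewrite -e cycle_id.
split; first by rewrite defc cycle_cyclic.
set q := #|z| in q_pr *.
have qg : q %| #[g] by rewrite orderE -defc cardSg.
have oX : #[g ^+ q] = #[g] %/ q by apply: orderXdiv.
have g_gt : q < #[g] by rewrite orderE -defc; apply: proper_card.
have [e1|ne1] := eqVneq <[g ^+ q]> 1.
  move: g_gt; rewrite ltn_neqAle eq_sym => /andP[/negP[]].
  by rewrite -(divnK qg) -oX orderE e1 cards1 mul1n.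
have [||e|e] := sub <[g ^+ q]>%G; rewrite ?cycle_subG ?groupX //.
  have := ltn_Pdiv (prime_gt1 q_pr) (order_gt0 g).
  by rewrite -oX !orderE -defc -e ltnn.
have oq : #[g ^+ q] = q := congr1 (fun K : {group gT} => #|K|) e.
by rewrite defc -orderE -(divnK qg) -oX oq mulnn.
Qed.

(** * Groups whose graph is the tree of a dihedral group *)

(** The shape of the graph of the dihedral group of order [2 p ^ 2], with root
    [z]: the child [c] is an end of the tree, every other child has [p] leaves,
    there are at least two such children, and no vertex is further from the
    root than these leaves. *)
Definition rooted_tree (gT : finGroupType) (G : {group gT}) p
    (z c : {group gT}) : Prop :=
  [/\ proper_subgroup G z, c \in neighbours G z /\ neighbours G c = [set z],
      {in neighbours G z, forall s, s != c ->
         #|neighbours G s| = p.+1 /\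
         {in neighbours G s, forall x, x != z -> neighbours G x = [set s]}},
      exists s, exists2 t, s != t & [/\ s \in neighbours G z,
         t \in neighbours G z, s != c & t != c]
    & forall H, proper_subgroup G H -> [\/ H = z, H \in neighbours G z
         | exists2 s, s \in neighbours G z & H \in neighbours G s]].

Lemma rooted_tree_iso (gT mT : finGroupType) (G : {group gT})
    (M : {group mT}) p z c :
    graph_iso (inclusion_graph G) (inclusion_graph M) ->
  rooted_tree M p z c -> exists z', exists c', rooted_tree G p z' c'.
Proof.
case/graph_iso_groups=> k [kI kP kS kN] [pz [zc cz] Ts [s [t nst [zs zt sc tc]]] cov].
have Np := neighbours_proper.
have kNmem H K : proper_subgroup M H -> K \in neighbours M H ->
    k K \in neighbours G (k H).
  by move=> pH NK; rewrite kN // imset_f.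
have kne H K : proper_subgroup M H -> proper_subgroup M K -> H != K ->
    k H != k K.
  by move=> pH pK; apply: contra_neq; apply: kI.
have [pc ps pt] := And3 (Np _ _ _ _ zc) (Np _ _ _ _ zs) (Np _ _ _ _ zt).
exists (k z), (k c); split=> [||S||H /kS[K pK ->]].
- exact: kP.
- by rewrite kNmem // kN // cz imset_set1.
- rewrite kN // => /imsetP[K zK ->{S}] nKc.
  have [|oK Kx] := Ts K zK; first by apply: contra_neq nKc => ->.
  have pK := Np _ _ _ _ zK; split=> [|X].
    rewrite kN // card_in_imset // => A B NA NB.
    by apply: kI; apply: Np; eassumption.
  rewrite kN // => /imsetP[L KL ->{X}] nLz.
  by rewrite kN ?(Np _ _ _ _ KL) // Kx ?imset_set1 //; apply: contra_neq nLz => ->.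
- by exists (k s), (k t); [apply: kne | split; rewrite ?kNmem ?kne].
- case: (cov K pK) => [->|zK|[L zL LK]]; first by constructor 1.
    by constructor 2; apply: kNmem.
  by constructor 3; exists (k L); rewrite kNmem //; apply: Np zL.
Qed.

Section RootAbove.
Variables (gT : finGroupType) (G z c : {group gT}) (p : nat).
Hypotheses (p_gt1 : 1 < p) (T : rooted_tree G p z c).

(** If the root contained its children, then the leaves over a child would be
    maximal subgroups of [G] containing it. Take a leaf [m1] over the child [s]
    and two leaves [m], [n] over the child [t]. As [t] is normalised by [m] and
    by [n], it is normal in [G], and so [G = m1 * t] by maximality of [m1]. But
    [m1] and [m] meet trivially, hence [#|m1| * #|m| <= #|G|], although [m]
    properly contains [t]. *)
Lemma root_above_absurd : c \proper z -> False.
Proof.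
have [pz [zc cz] Ts [s [t nst [zs zt sc tc]]] cov] := T => c_lt_z.
have below u : u \in neighbours G z -> u \proper z.
  move=> zu; have /neighboursP[pu [z_u|//]] := zu.
  have: u \in neighbours G c.
    by apply/neighboursP; split=> //; left; apply: proper_trans z_u.
  by rewrite cz => /set1P uz; rewrite uz properxx in z_u.
have leaf u : u \in neighbours G z -> u != c ->
    exists m, exists2 n, m != n &
      {in [set m; n], forall y, [/\ proper_subgroup G y,
         neighbours G y = [set u] & u \proper y]}.
  move=> zu uc; have [oN ux] := Ts u zu uc.
  have pu := neighbours_proper zu.
  have leaf1 x : x \in neighbours G u :\ z ->
     [/\ proper_subgroup G x, neighbours G x = [set u] & u \proper x].
    case/setD1P=> xz xu; have Nx := ux x xu xz.
    split=> //; first exact: neighbours_proper xu.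
    have /neighboursP[px [//|xltu]] := xu.
    have: z \in neighbours G x.
      by apply/neighboursP; split=> //; left; apply: proper_trans xltu (below u zu).
    by rewrite Nx => /set1P zu'; have := below u zu; rewrite zu' properxx.
  have oN1 : #|neighbours G u :\ z| = p.
    by move: oN; rewrite (cardsD1 z) neighboursC // => - [].
  have /card_gt1P[m [n [Nm Nn nmn]]]: 1 < #|neighbours G u :\ z| by rewrite oN1.
  by exists m, n => // y /set2P[]->; apply: leaf1.
have [m1 [_ _ /(_ m1 (set21 _ _))[pm1 Nm1 sm1]]] := leaf s zs sc.
have [m [n nmn L]] := leaf t zt tc.
have [pm Nm tm] := L m (set21 _ _); have [pn Nn tn] := L n (set22 _ _).
have pt := neighbours_proper zt.
have [nzt nzs] : z != t /\ z != s.
  by split; apply: contraTneq isT => e; [have:= below t zt | have := below s zs];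
     rewrite e properxx.
have nm1t : m1 != t.
  apply: contraTneq isT => e; have : z \in neighbours G m1.
    by rewrite e; apply: neighboursC.
  by rewrite Nm1 inE (negPf nzs).
have nms : m != s.
  apply: contraTneq isT => e; have : z \in neighbours G m.
    by rewrite e; apply: neighboursC.
  by rewrite Nm inE (negPf nzt).
have GN : G \subset 'N(t).
  have mG := end_vertex_norm pm Nm tm pt; have nG := end_vertex_norm pn Nn tn pt.
  have <- : m <*> n = G; last by rewrite join_subG mG.
  apply: (end_vertex_above pm Nm tm); rewrite ?joing_subl //.
    by rewrite join_subG; case/and3P: pm => ->; case/and3P: pn => ->.
  apply: contra_neq nmn => e.
  have [||eN|eN] := @end_vertex_below _ G m t pm Nm n.
  - by rewrite -e joing_subr.
  - by case/and3P: pn.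
  - by [].
  by move: tn; rewrite eN properxx.
have /and3P[tG t1 _] := pt; have /and3P[m1G _ _] := pm1.
have joinE : m1 <*> t = G.
  apply: (end_vertex_above pm1 Nm1 sm1); rewrite ?joing_subl ?join_subG ?m1G //.
  apply: contraTneq isT => e.
  have [||e'|e'] := @end_vertex_below _ G m1 s pm1 Nm1 t.
  - by rewrite -e joing_subr.
  - by [].
  - by rewrite e' eqxx in nm1t.
  by rewrite e' eqxx in nst.
have oG : #|G| <= #|m1| * #|t|.
  by rewrite -joinE norm_joinEl ?(subset_trans m1G) // mul_cardG leq_pmulr.
have TI : m1 :&: m = 1.
  have [K defK] : exists K : {group gT}, K :=: m1 :&: m by exists (m1 :&: m)%G.
  rewrite -defK; apply: contraTeq isT => K1.
  have Km1 : K \subset m1 by rewrite defK subsetIl.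
  have Km : K \subset m by rewrite defK subsetIr.
  have [e1|e1] := end_vertex_below pm1 Nm1 Km1 K1;
  have [e2|e2] := end_vertex_below pm Nm Km K1.
  - move: Nm; rewrite -e2 e1 Nm1 => /set1_inj e.
    by rewrite e eqxx in nst.
  - by move: nm1t; rewrite -e1 e2 eqxx.
  - by move: nms; rewrite -e2 e1 eqxx.
  by move: nst; rewrite -e1 e2 eqxx.
have : #|m1 * m| <= #|G| by rewrite subset_leq_card // mul_subG //; case/and3P: pm.
rewrite TI_cardMg // => /leq_trans/(_ oG).
by rewrite leq_pmul2l // leqNgt proper_card.
Qed.

Lemma root_below : z \proper c.
Proof.
have [_ [/neighboursP[_ [//|/root_above_absurd//]] _] _ _ _] := T.
Qed.
End RootAbove.

(** Modulo the square of a prime the only square roots of 1 are 1 and -1; the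
    two primes at hand are settled by enumeration. *)
Lemma sqrt1_mod_prime_square p k : prime p -> p <= 3 -> k < p ^ 2 ->
  k * k = 1 %[mod p ^ 2] -> k = 1%N \/ k.+1 = (p ^ 2)%N.
Proof.
case: p => [|[|[|[|p]]]] //= _ _.
  by do 4?[case: k => [|k]] => // _ _; solve [by left | by right].
by do 9?[case: k => [|k]] => // _ _; solve [by left | by right].
Qed.

Section RootBelow.
Variables (gT : finGroupType) (G z c : {group gT}) (p : nat).
Hypotheses (p_pr : prime p) (T : rooted_tree G p z c).

Let pz : proper_subgroup G z. Proof. by case: T. Qed.
Let zc : c \in neighbours G z. Proof. by case: T => _ []. Qed.
Let pc : proper_subgroup G c. Proof. exact: neighbours_proper zc. Qed.
Let Nc : neighbours G c = [set z]. Proof. by case: T => _ []. Qed.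
Let c_above : z \proper c. Proof. exact: root_below (prime_gt1 p_pr) T. Qed.

Lemma child_above u : u \in neighbours G z -> z \proper u.
Proof.
move=> zu; have /neighboursP[pu [//|u_lt_z]] := zu.
have: u \in neighbours G c.
  by apply/neighboursP; split=> //; right; apply: proper_trans c_above.
by rewrite Nc => /set1P uz; rewrite uz properxx in u_lt_z.
Qed.

Lemma root_prime : prime #|z|.
Proof.
apply: minimal_vertex_prime pz _ => K /child_above zK.
by rewrite properE (proper_sub zK) andbF.
Qed.

Section Branch.
Variable s : {group gT}.
Hypotheses (zs : s \in neighbours G z) (nsc : s != c).

Let ps : proper_subgroup G s. Proof. exact: neighbours_proper zs. Qed.

Lemma leaf_neighbours x :
  x \in neighbours G s -> x != z -> neighbours G x = [set s].
Proof. by have [_ _ /(_ s zs nsc)[_ Ns] _ _] := T; apply: Ns. Qed.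

Lemma leaf_not_above x : x \in neighbours G s -> z \proper x -> False.
Proof.
move=> sx z_lt_x; have nxz : x != z by apply: contraTneq z_lt_x => ->; rewrite properxx.
have: z \in neighbours G x by apply/neighboursP; split=> //; right.
rewrite leaf_neighbours // => /set1P zs'.
by have := child_above zs; rewrite zs' properxx.
Qed.

Lemma leaf_below x : x \in neighbours G s -> x \proper s.
Proof.
move=> sx; have /neighboursP[px [s_lt_x|//]] := sx.
by case: (leaf_not_above sx); apply: proper_trans (child_above zs) s_lt_x.
Qed.

Lemma branch_maximal (K : {group gT}) :
  s \subset K -> K \subset G -> K :!=: s -> K :=: G.
Proof.
move=> sK KG nKs; apply: contraTeq isT => nKG.
have s_lt_K : s \proper K by rewrite properEneq eq_sym nKs.
by have /leaf_below := upper_neighbour ps s_lt_K KG nKG; rewrite properE sK andbF.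
Qed.

Lemma leaf_exists : exists2 x, x \in neighbours G s & x != z.
Proof.
have [_ _ /(_ s zs nsc)[oN _] _ _] := T.
have: 0 < #|neighbours G s :\ z|.
  move: oN; rewrite (cardsD1 z) (neighboursC pz zs) add1n => - [->].
  exact: prime_gt0.
by case/card_gt0P=> x /setD1P[nxz sx]; exists x.
Qed.

Section Leaf.
Variable x : {group gT}.
Hypotheses (sx : x \in neighbours G s) (nxz : x != z).

Let px : proper_subgroup G x. Proof. exact: neighbours_proper sx. Qed.

Lemma leaf_prime : prime #|x|.
Proof.
apply: minimal_vertex_prime px _ => K; rewrite leaf_neighbours // => /set1P->.
by rewrite properE (proper_sub (leaf_below sx)) andbF.
Qed.

Lemma leaf_notin_child : ~~ (x \subset c).
Proof.
apply: contraL nxz => xc; have x1 : x :!=: 1 by case/and3P: px.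
have [e | ->] := end_vertex_below pc Nc xc x1; last by rewrite eqxx.
move: Nc (leaf_neighbours sx nxz); rewrite e => -> /set1_inj zs'.
by have := child_above zs; rewrite zs' properxx.
Qed.

Lemma leaf_TI_root : z :&: x = 1.
Proof.
rewrite setIC; apply: prime_TIg leaf_prime _.
by apply: contraNN leaf_notin_child => xz; rewrite (subset_trans xz) // proper_sub.
Qed.

Lemma leaf_TI_child : c :&: x = 1.
Proof. by rewrite setIC prime_TIg ?leaf_prime ?leaf_notin_child. Qed.

End Leaf.
End Branch.

Let two_branches : exists s, exists2 t, s != t &
  [/\ s \in neighbours G z, t \in neighbours G z, s != c & t != c].
Proof. by case: T. Qed.

(** A conjugate of [z] that is a leaf would have a single neighbour, whereas the
    conjugates of [c] and of another child of [z] are two neighbours of it. *)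
Lemma root_normal : G \subset 'N(z).
Proof.
apply/subsetP=> g Gg; rewrite inE.
have pzg := conj_proper Gg pz; have [_ _ _ _ cov] := T.
suff /(congr1 val)/= -> : (z :^ g)%G = z by [].
have [//|zg|[s zs szg]] := cov _ pzg.
  by have := proper_card (child_above zg); rewrite /= cardJg ltnn.
apply: contraTeq isT => nzg; have nsc : s != c.
  by apply: contra_neq nzg => e; move: szg; rewrite e Nc => /set1P.
have [t zt ntc] : exists2 t, t \in neighbours G z & t != c.
  by have [t [t' _ [zt _ ntc _]]] := two_branches; exists t.
have Ng := leaf_neighbours zs nsc szg nzg.
have := conj_neighbour Gg pc c_above.
have := conj_neighbour Gg (neighbours_proper zt) (child_above zt).
rewrite Ng => /set1P <- /set1P/(congr1 val)/= /(can_inj (conjsgK g)) e.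
by case/eqP: ntc; apply/esym/group_inj.
Qed.

Section BranchProduct.
Variable s x : {group gT}.
Hypotheses (zs : s \in neighbours G z) (nsc : s != c).
Hypotheses (sx : x \in neighbours G s) (nxz : x != z).

(** Besides [z] no neighbour of [s] contains [z], so [z * x], which is a group
    since [z] is normal, cannot be a proper subgroup of [s]. *)
Lemma branch_eq : z * x = s.
Proof.
have /and3P[xG x1 _] := neighbours_proper sx.
have zxs : z <*> x \subset s.
  by rewrite join_subG (proper_sub (child_above zs)) (proper_sub (leaf_below zs nsc sx)).
have TIzx := leaf_TI_root zs nsc sx nxz.
rewrite -(norm_joinEr (subset_trans xG root_normal)).
apply: contraTeq isT => nzxs.
have zx_lt_s : (z <*> x)%G \proper s by rewrite properEneq nzxs.
have z_lt_zx : z \proper (z <*> x)%G.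
  rewrite properE joing_subl join_subG subxx /=.
  by apply: contra x1 => xz; rewrite -subG1 -TIzx subsetI xz subxx.
suff nt_zx : (z <*> x)%G :!=: 1.
  have szx := lower_neighbour (neighbours_proper zs) zx_lt_s nt_zx.
  by case: (leaf_not_above zs nsc szx z_lt_zx).
by apply: contraTneq z_lt_zx => ->; rewrite properE sub1G andbF.
Qed.

Lemma card_branch : #|s| = (#|z| * #|x|)%N.
Proof. by rewrite -branch_eq TI_cardMg // (leaf_TI_root zs nsc). Qed.
End BranchProduct.

Lemma child_cyclic : cyclic c /\ #|c| = (#|z| ^ 2)%N.
Proof. exact: end_vertex_cyclic pc Nc c_above root_prime. Qed.

(** A conjugate of [c] contains [z], so it is a child of [z]. Like [c], it has a
    single nontrivial proper subgroup, whereas every other child contains a leaf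
    besides [z]. *)
Lemma child_normal : G \subset 'N(c).
Proof.
apply/subsetP=> g Gg; rewrite inE.
suff /(congr1 val)/= -> : (c :^ g)%G = c by [].
have zg : z :^ g = z by apply: normP; apply: (subsetP root_normal).
have zcg : (c :^ g)%G \in neighbours G z.
  apply/neighboursP; split; first exact: conj_proper.
  by left; rewrite /= -{1}zg properJ.
apply: contraTeq isT => ncg; have [x sx nxz] := leaf_exists zcg ncg.
have /and3P[_ x1 _] := neighbours_proper sx.
have x_lt := leaf_below zcg ncg sx.
have xc : (x :^ g^-1)%G \subset c by rewrite /= sub_conjgV proper_sub.
have [|e|e] := end_vertex_below pc Nc xc; first by rewrite conjsg_eq1.
  by move: (proper_card x_lt); rewrite /= cardJg -e /= cardJg ltnn.
case/eqP: nxz; apply: group_inj; rewrite -zg -e /=.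
by rewrite conjsgKV.
Qed.

Section GroupProduct.
Variable s x : {group gT}.
Hypotheses (zs : s \in neighbours G z) (nsc : s != c).
Hypotheses (sx : x \in neighbours G s) (nxz : x != z).

Lemma group_eq : c * x = G.
Proof.
have /and3P[xG x1 _] := neighbours_proper sx.
rewrite -(norm_joinEr (subset_trans xG child_normal)).
apply: (end_vertex_above pc Nc c_above); rewrite ?joing_subl //.
  by rewrite join_subG xG; case/and3P: pc => ->.
apply: contraNneq (leaf_notin_child zs nsc sx nxz) => <-.
exact: joing_subr.
Qed.

Lemma card_group : #|G| = (#|z| ^ 2 * #|x|)%N.
Proof.
rewrite -group_eq TI_cardMg ?(leaf_TI_child zs nsc) //.
by case: child_cyclic => _ ->.
Qed.
End GroupProduct.

Lemma leaf_card s t x y : s \in neighbours G z -> s != c ->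
    t \in neighbours G z -> t != c -> x \in neighbours G s -> x != z ->
    y \in neighbours G t -> y != z -> #|x| = #|y|.
Proof.
move=> zs sc zt tc sx xz ty yz; have := card_group zs sc sx xz.
rewrite (card_group zt tc ty yz) => /eqP.
by rewrite eqn_pmul2l ?expn_gt0 ?cardG_gt0 // => /eqP.
Qed.

Section Count.
Variable s x : {group gT}.
Hypotheses (zs : s \in neighbours G z) (nsc : s != c).
Hypotheses (sx : x \in neighbours G s) (nxz : x != z).

(** The neighbours of [s = z * x] are its nontrivial proper subgroups. If [x] and
    [z] have the same order [q], then [s] is elementary abelian and has [q + 1]
    subgroups of order [q]. Otherwise the [p] leaves are the Sylow subgroups of
    [s] for the prime [#|x|], and Sylow's theorem gives [p %| #|z| * #|x|] and
    [p = 1] modulo [#|x|], which excludes [p = #|x|]. *)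
Lemma leaves_count :
  #|z| = p /\ (#|x| = p \/ p %% #|x| = 1%N).
Proof.
have q_pr := root_prime; have r_pr := leaf_prime zs nsc sx nxz.
have os := card_branch zs nsc sx nxz.
have [_ _ /(_ s zs nsc)[oN _] _ _] := T.
have sz : z \in neighbours G s := neighboursC pz zs.
have sub_s K : K \in neighbours G s -> K \subset s.
  by move=> sK; rewrite proper_sub // leaf_below.
have memN (K : {group gT}) : K \subset s -> prime #|K| -> K \in neighbours G s.
  move=> Ks K_pr; apply: (lower_neighbour (neighbours_proper zs)).
    rewrite properEcard Ks os /=; apply: contraLR K_pr => le_zxK.
    have /eqP -> : #|K| == (#|z| * #|x|)%N.
      by rewrite eqn_leq (leqNgt (_ * _)) le_zxK -os subset_leq_card.
    apply/negP=> /primeP[_ /(_ _ (dvdn_mulr _ (dvdnn _)))/pred2P[e|]].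
      by rewrite e in q_pr.
    rewrite -{1}[#|z|]muln1 => /eqP; rewrite eqn_pmul2l ?cardG_gt0 // => /eqP e.
    by rewrite -e in r_pr.
  by rewrite -cardG_gt1 prime_gt1.
have oL K : K \in neighbours G s -> K != z -> #|K| = #|x|.
  by move=> sK Kz; apply: leaf_card zs nsc zs nsc sK Kz sx nxz.
have [e|nqr] := eqVneq #|x| #|z|.
  suff : #|neighbours G s| = #|z|.+1 by rewrite oN => - [->]; split=> //; left.
  have abs : abelian s.
    by apply: (@card_p2group_abelian _ #|z|); rewrite // os e mulnn.
  have es : #|z|.-abelem s.
    rewrite abelemE // abs; apply/exponentP=> y; rewrite -(branch_eq zs nsc sx nxz).
    case/mulsgP=> u v zu xv ->{y}; rewrite expgMn; last first.
      apply: (centsP abs); first exact: (subsetP (sub_s _ sz)).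
      exact: (subsetP (sub_s _ sx)).
    by rewrite -{2}e !expg_cardG // mulg1.
  have /card_p1Elem_p2Elem <- : s \in 'E_#|z|^2(s).
    by apply/pnElemP; rewrite es subxx os e mulnn pfactorK.
  apply: eq_card => K; rewrite p1ElemE // [RHS]inE [K \in subgroups _]inE.
  apply/idP/andP=> [sK | [Ks /eqP oK]]; last by apply: memN; rewrite ?oK.
  by rewrite sub_s //; have [->//|Kz] := eqVneq K z; rewrite oL ?e.
have oSyl : #|'Syl_#|x|(s)| = p.
  have <- : #|neighbours G s :\ z| = p.
    by move: oN; rewrite (cardsD1 z) sz add1n => - [].
  apply: eq_card => K; rewrite inE pHallE in_setD1.
  have -> : (#|s|`_#|x|)%N = #|x|.
    rewrite os partnM ?cardG_gt0 // [(#|x|`__)%N]part_pnat_id ?pnat_id //.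
    by rewrite part_p'nat ?mul1n // p'natE // dvdn_prime2.
  apply/andP/andP=> [[Ks /eqP oK] | [Kz sK]]; last by rewrite sub_s ?oL.
  split; last by rewrite memN ?oK.
  by apply: contra_neq nqr => <-.
have modp := card_Syl_mod s r_pr; have := card_Syl_dvd #|x| s.
rewrite oSyl in modp *; rewrite os Euclid_dvdM // !dvdn_prime2 //.
case/orP=> /eqP e; first by split; [|right].
by move: modp; rewrite e modnn.
Qed.

(** The children of [z] other than [c] are maximal subgroups generated by
    elements of order [p], and two of them generate [G]. *)
Lemma p_group_Ohm : #|x| = p -> p.-group G /\ 'Ohm_1(G) = G.
Proof.
have [oz _] := leaves_count => ox.
have pG : p.-group G.
  by rewrite /pgroup (card_group zs nsc sx nxz) oz ox pnatM pnatX pnat_id.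
split=> //.
have sub_Ohm t : t \in neighbours G z -> t != c -> t \subset 'Ohm_1(G).
  move=> zt ntc; have [y ty nyz] := leaf_exists zt ntc.
  have oy : #|y| = p by rewrite -ox; apply: leaf_card zt ntc zs nsc ty nyz sx nxz.
  have subO (K : {group gT}) : proper_subgroup G K -> #|K| = p -> K \subset 'Ohm_1(G).
    case/and3P=> KG _ _ oK; rewrite (OhmE 1 pG); apply: subset_trans (subset_gen _).
    apply/subsetP=> u Ku; rewrite !inE (subsetP KG) //= expn1 -oK.
    by rewrite expg_cardG.
  by rewrite -(branch_eq zt ntc ty nyz) mul_subG // subO // (neighbours_proper ty).
have [t [u ntu [zt zu ntc nuc]]] := two_branches.
have Ot := sub_Ohm _ zt ntc; have Ou := sub_Ohm _ zu nuc.
apply: (branch_maximal zt ntc Ot (Ohm_sub 1 G)).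
apply: contra_neq ntu => e; rewrite /= e in Ou.
apply: contraTeq isT => ntu.
have uG : t :=: G.
  apply: (branch_maximal zu nuc Ou); first by have /and3P[] := neighbours_proper zt.
  by apply: contra_neq ntu => /group_inj.
by have /and3P[_ _] := neighbours_proper zt; rewrite uG eqxx.
Qed.

(** Otherwise [G] is a group of order [p ^ 3], of nilpotency class at most 2. For
    odd [p], such a group generated by elements of order [p] has exponent [p],
    and cannot contain the cyclic group [c] of order [p ^ 2]. *)
Lemma leaf_card_neq_odd : odd p -> #|x| != p.
Proof.
move=> odd_p; apply/eqP=> ox; have [pG OG] := p_group_Ohm ox.
have [oz _] := leaves_count; have /and3P[zG z1 _] := pz.
have nz : z <| G by rewrite /normal zG root_normal.
have z_center : z \subset 'Z(G).
  apply: (subset_trans _ (subsetIr z _)); apply: (prime_meetG root_prime).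
  by rewrite setIA setIid meet_center_nil // (pgroup_nil pG).
have ab_quot : abelian (G / z).
  apply: (card_p2group_abelian p_pr); rewrite card_quotient ?root_normal //.
  by rewrite -divgS // (card_group zs nsc sx nxz) oz ox mulnK ?prime_gt0.
have class2 : nil_class G <= 2.
  by rewrite nil_class2 (subset_trans _ z_center) // der1_min ?root_normal.
have := exponent_Ohm1_class2 odd_p pG class2; rewrite OG => expG.
have [cyc oc] := child_cyclic; have /and3P[cG _ _] := pc.
have := dvdn_trans (exponentS cG) expG.
rewrite exponent_cyclic // oc oz -{2}(expn1 p) dvdn_Pexp2l //.
exact: prime_gt1.
Qed.

End Count.

(** Take leaves [x] and [y] of two different children. If [G] is abelian, [x <*> y]
    has order [#|x| ^ 2], which divides [#|G| = p ^ 2 * #|x|] only if [#|x| = p].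
    Then [G] is elementary abelian, contrary to the existence of [c]. *)
Lemma not_abelian : ~~ abelian G.
Proof.
apply/negP=> abG; have [s [t nst [zs zt nsc ntc]]] := two_branches.
have [x sx nxz] := leaf_exists zs nsc; have [y ty nyz] := leaf_exists zt ntc.
have [oz _] := leaves_count zs nsc sx nxz.
have exy := leaf_card zs nsc zt ntc sx nxz ty nyz.
have x_pr := leaf_prime zs nsc sx nxz.
have [xG yG] : x \subset G /\ y \subset G.
  by case/and3P: (neighbours_proper sx) (neighbours_proper ty) => -> _ _ /and3P[].
suff ox : #|x| = p.
  have [pG OG] := p_group_Ohm zs nsc sx nxz ox; have := Ohm1_abelem pG abG.
  rewrite OG => abelG; have /and3P[cG c1 _] := pc; have [cyc oc] := child_cyclic.
  have := cyclic_abelem_prime (abelemS cG abelG) cyc c1.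
  rewrite oc oz => /eqP; rewrite -{2}(expn1 p) eqn_exp2l //.
  exact: prime_gt1.
have TIxy : x :&: y = 1.
  apply: prime_TIg => //; apply: contra_neqN nst => xy.
  apply: set1_inj; rewrite -(leaf_neighbours zs nsc sx nxz).
  rewrite -(leaf_neighbours zt ntc ty nyz); congr (neighbours G _).
  by apply: group_inj; apply/eqP; rewrite eqEcard xy exy leqnn.
have : #|x <*> y| %| #|G| by rewrite cardSg // join_subG xG.
rewrite norm_joinEr ?(subset_trans yG) ?(sub_abelian_norm abG) // TI_cardMg // -exy.
rewrite (card_group zs nsc sx nxz) oz dvdn_pmul2r ?cardG_gt0 //.
by rewrite Euclid_dvdX // andbT dvdn_prime2 // => /eqP.
Qed.

Lemma rooted_tree_dihedral : p <= 3 -> G \isog 'D_((p ^ 2).*2).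
Proof.
move=> p_le3; have [s [_ _ [zs _ nsc _]]] := two_branches.
have [x sx nxz] := leaf_exists zs nsc.
have [oz ox'] := leaves_count zs nsc sx nxz.
have x_pr := leaf_prime zs nsc sx nxz.
have ox : #|x| = 2.
  have := leaf_card_neq_odd zs nsc sx nxz.
  move: x_pr p_pr p_le3 ox'; case: #|x| p => [|[|[|r]]] [|[|[|[|q]]]] //= _ _ _.
    by case=> //; rewrite modn_small.
  case: r => [_ /(_ isT)//|r]; case=> [[]//|].
  by rewrite modn_small.
have [cyc oc] := child_cyclic; rewrite oz in oc.
have [t defx] : exists t, x :=: <[t]>.
  by apply/cyclicP; rewrite prime_cyclic.
have /cyclicP[a defc] := cyc.
have ot : #[t] = 2 by rewrite orderE -defx.
have oa : #[a] = (p ^ 2)%N by rewrite orderE -defc.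
have defG : <[a]> * <[t]> = G by rewrite -defc -defx (group_eq zs nsc sx nxz).
have tG : t \in G by rewrite -cycle_subG -defx; case/and3P: (neighbours_proper sx).
have p2_gt1 : 1 < p ^ 2 by rewrite -[1%N](expn0 p) ltn_exp2l ?prime_gt1.
have [k ltk atk] : exists2 k, k < p ^ 2 & a ^ t = a ^+ k.
  have: a ^ t \in <[a]>.
    by rewrite -defc memJ_norm ?(subsetP child_normal) // defc cycle_id.
  case/cycleP=> k ->; exists (k %% p ^ 2); first by rewrite ltn_pmod // ltnW.
  by rewrite -oa expg_mod_order.
have k2 : k * k = 1 %[mod p ^ 2].
  apply/eqP; rewrite -oa -eq_expg_mod_order expgM -atk -conjXg -atk.
  by rewrite -conjgM -expg2 -ot expg_order conjg1 expg1.
have [k1 | kV] : k = 1%N \/ k.+1 = (p ^ 2)%N.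
- exact: sqrt1_mod_prime_square p_pr p_le3 ltk k2.
- case/negP: not_abelian; rewrite -defG abelianM !cycle_abelian /= cent_cycle cycle_subG.
  by apply/cent1P/commute_sym/commgP/conjg_fixP; rewrite atk k1.
have at_inv : a ^ t = a^-1.
  by rewrite atk; apply: (mulgI a); rewrite -expgS kV -oa expg_order mulgV.
have iso := Grp_dihedral p2_gt1.
apply/(isoGrpP _ iso); split.
  by rewrite (card_dihedral p2_gt1) (card_group zs nsc sx nxz) oz ox muln2.
apply/existsP; exists (a, t); rewrite /= !xpair_eqE -oa expg_order -ot expg_order.
rewrite at_inv !eqxx !andbT; apply/eqP.
by rewrite norm_joinEr //= cycle_subG -defc (subsetP child_normal).
Qed.
End RootBelow.

(** * The graph of a dihedral group of order [2 p ^ 2] *)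

(** The dihedral group is described by its cyclic subgroup [c] of index 2, the
    rotations, outside which all elements are involutions. *)

Section DihedralTree.
Variables (gT : finGroupType) (G c : {group gT}) (p : nat).
Hypotheses (p_pr : prime p) (cyc : cyclic c) (oc : #|c| = (p ^ 2)%N).
Hypotheses (cG : c \subset G) (oG : #|G| = (p ^ 2).*2).
Hypothesis invol : {in G :\: c, forall g, #[g] = 2}.

Let p_gt1 : 1 < p. Proof. exact: prime_gt1. Qed.

Lemma rotation_root : exists z : {group gT}, z \subset c /\ #|z| = p.
Proof.
have [x cx ox] : {x | x \in c & #[x] = p}.
  by apply: Cauchy => //; rewrite oc dvdn_exp.
by exists <[x]>%G; rewrite cycle_subG.
Qed.

Let index_c : #|G : c| = 2.
Proof. by rewrite -divgS // oG oc -muln2 mulKn // expn_gt0 prime_gt0. Qed.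

Let normal_c : c <| G. Proof. exact: index2_normal. Qed.

Section Root.
Variable z : {group gT}.
Hypotheses (zc : z \subset c) (oz : #|z| = p).

Lemma rotation_subgroups (H : {group gT}) :
  H \subset c -> [\/ H :=: 1, H = z | H = c].
Proof.
move=> Hc; have /(dvdn_pfactor _ _ p_pr)[k le_k2 oH] : #|H| %| p ^ 2.
  by rewrite -oc cardSg.
have cmp (K : {group gT}) : K \subset c -> #|H| = #|K| -> H = K.
  by move=> Kc oHK; apply: group_inj; apply/eqP; rewrite (eq_subG_cyclic cyc) // oHK.
case: k le_k2 oH => [|[|[|//]]] _ oH.
- by constructor 1; apply/eqP; rewrite trivg_card1 oH.
- by constructor 2; apply: cmp; rewrite // oz.
by constructor 3; apply: cmp; rewrite // oc.
Qed.

(** [c] has index 2, so that [H * c = G] as soon as [H] has a reflection. *)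
Lemma reflection_subgroups (H : {group gT}) :
  H \subset G -> ~~ (H \subset c) -> #|H| = #|H :&: c|.*2.
Proof.
move=> HG nHc; have := mul_cardG H c.
have -> : H * c = G.
  rewrite normC; last exact: subset_trans HG (normal_norm normal_c).
  by rewrite (mulg_normal_maximal normal_c) // p_index_maximal ?index_c.
rewrite oG oc -!mul2n [RHS]mulnAC => /eqP.
by rewrite eqn_pmul2r ?expn_gt0 ?prime_gt0 // => /eqP.
Qed.

Let z1 : z :!=: 1. Proof. by rewrite -cardG_gt1 oz. Qed.

Let ncz : ~~ (c \subset z).
Proof.
apply/negP=> /subset_leq_card; rewrite oc oz leqNgt -{1}(expn1 p).
by rewrite ltn_exp2l.
Qed.

Lemma dihedral_subgroups (H : {group gT}) : proper_subgroup G H ->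
  [\/ H = z, H = c,
      [/\ ~~ (H \subset c), #|H| = 2 & H :&: c = 1]
    | [/\ ~~ (H \subset c), #|H| = p.*2 & H :&: c = z]].
Proof.
case/and3P=> HG H1 nHG; have [Hc | nHc] := boolP (H \subset c).
  have [e | -> | ->] := rotation_subgroups Hc; last by constructor 2.
    by rewrite e eqxx in H1.
  by constructor 1.
have oH := reflection_subgroups HG nHc.
have [/= e | /(congr1 val)/= e | /(congr1 val)/= e] :=
  @rotation_subgroups (H :&: c)%G (subsetIr H c).
- by constructor 3; rewrite oH e cards1.
- by constructor 4; rewrite oH e oz.
by case/eqP: nHG; apply/eqP; rewrite eqEcard HG oH e oc oG leqnn.
Qed.

Let zG : z \subset G. Proof. exact: subset_trans zc cG. Qed.

Let z_normal : G \subset 'N(z).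
Proof.
by apply/normal_norm/(char_normal_trans _ normal_c); rewrite sub_cyclic_char.
Qed.

Let small : p.*2 < (p ^ 2).*2.
Proof. by rewrite ltn_double -{1}(expn1 p) ltn_exp2l. Qed.

Let pz : proper_subgroup G z.
Proof.
rewrite /proper_subgroup zG z1; apply: contraNneq ncz => ->; exact: cG.
Qed.

Let pc : proper_subgroup G c.
Proof.
rewrite /proper_subgroup cG /=; apply/andP; split.
  by apply: contraNneq ncz => ->; apply: sub1G.
apply: contraTneq isT => e; have := oG.
rewrite -e oc -addnn -{1}[(p ^ 2)%N]addn0 => /addnI/esym/eqP.
by rewrite expn_eq0 andbT -leqn0 leqNgt prime_gt0.
Qed.

Let z_lt_c : z \proper c. Proof. by rewrite properE zc. Qed.

Lemma rotations_neighbours : neighbours G c = [set z].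
Proof.
apply/setP=> H; rewrite !inE; apply/and3P/eqP=> [[pH ncH cmp] | ->]; last first.
  split=> //; last by rewrite zc orbT.
  by apply: contraNneq ncz => ->.
have [//|e|[nHc oH HIc]|[nHc oH HIc]] := dihedral_subgroups pH.
- by rewrite e eqxx in ncH.
- move: cmp; rewrite (negPf nHc) orbF => cH.
  by case/negP: ncz; rewrite -(setIidPr cH) HIc sub1G.
move: cmp; rewrite (negPf nHc) orbF => cH.
by case/negP: ncz; rewrite -(setIidPr cH) HIc.
Qed.

Section Branch.
Variable x : {group gT}.
Hypotheses (xG : x \subset G) (nxc : ~~ (x \subset c)) (ox : #|x| = 2).
Hypothesis TIx : x :&: c = 1.

Lemma card_join_branch : #|z <*> x| = p.*2.
Proof.
rewrite norm_joinEr ?(subset_trans xG) // TI_cardMg ?oz ?ox ?muln2 //.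
by apply/trivgP; rewrite -TIx subsetI subsetIr subIset ?zc.
Qed.

Lemma join_branch_neighbour :
  [/\ (z <*> x)%G \in neighbours G z, (z <*> x)%G != c
    & x \in neighbours G (z <*> x)%G].
Proof.
have oj := card_join_branch; have jG : z <*> x \subset G by rewrite join_subG zG.
have nxz : ~~ (x \subset z) by apply: contra nxc => /subset_trans->.
have pj : proper_subgroup G (z <*> x)%G.
  rewrite /proper_subgroup jG /=; apply/andP; split.
    by rewrite -cardG_gt1 oj -addnn ltn_addl.
  by apply: contraTneq small => e; rewrite -oG -e oj ltnn.
split.
- apply/neighboursP; split=> //; left.
  by rewrite properE joing_subl join_subG subxx.
- by apply: contraNneq nxc => <-; rewrite joing_subr.
apply/neighboursP; split; last first.
  by right; rewrite properEcard joing_subr oj ox -addnn (leq_add p_gt1 (ltnW p_gt1)).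
rewrite /proper_subgroup xG -cardG_gt1 ox /=.
apply: contraNneq nxc => e; have := oG; rewrite -e ox => e2.
by move: small; rewrite -e2 -muln2 -{2}[2]mul1n ltn_mul2r /= ltnNge ltnW.
Qed.

End Branch.

Lemma branchP (s : {group gT}) : s \in neighbours G z -> s != c ->
  [/\ ~~ (s \subset c), #|s| = p.*2 & s :&: c = z].
Proof.
case/neighboursP=> ps cmp nsc.
have [e|e|[nsc' os sIc]|//] := dihedral_subgroups ps.
- by case: cmp; rewrite e properxx.
- by rewrite e eqxx in nsc.
case: cmp => /proper_sub sub; last by rewrite (subset_trans sub) in nsc'.
by case/negP: z1; rewrite -subG1 -sIc subsetI sub.
Qed.

Lemma leafP (s x : {group gT}) : s \in neighbours G z -> s != c ->
    x \in neighbours G s -> x != z ->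
  [/\ x \subset s, ~~ (x \subset c), #|x| = 2 & x :&: c = 1].
Proof.
move=> zs nsc /neighboursP[px cmp] nxz.
have [nsc' os sIc] := branchP zs nsc.
have [e|e|[nxc ox xIc]|[nxc ox xIc]] := dihedral_subgroups px.
- by rewrite e eqxx in nxz.
- case: cmp => /proper_sub sub; first by rewrite -e sub in nsc'.
  by case/negP: ncz; rewrite -{1}e -sIc subsetI sub e subxx.
- case: cmp => [/proper_card|/proper_sub->//].
  by rewrite os ox ltnNge -addnn (leq_add (ltnW p_gt1) (ltnW p_gt1)).
by case: cmp => /proper_card; rewrite os ox ltnn.
Qed.

(** The leaves of [s] are generated by the [p] elements of [s] outside [z]. *)
Lemma branch_degree (s : {group gT}) : s \in neighbours G z -> s != c ->
  #|neighbours G s| = p.+1.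
Proof.
move=> zs nsc; have [nsc' os sIc] := branchP zs nsc.
have ps := neighbours_proper zs; have /and3P[sG _ _] := ps.
have zs' : z \subset s by rewrite -sIc subsetIl.
have invs g : g \in s :\: z -> #[g] = 2 /\ g \notin c.
  case/setDP=> gs gz.
  have gc : g \notin c by apply: contra gz => gc; rewrite -sIc inE gs.
  by rewrite invol // inE gc (subsetP sG).
have -> : neighbours G s = z |: [set <[g]>%G | g in s :\: z].
  apply/setP=> x; rewrite in_setU1; have [->|nxz] := eqVneq x z.
    exact: neighboursC.
  apply/idP/imsetP=> [sx | [g sg ->{x nxz}]].
    have [xs nxc ox xIc] := leafP zs nsc sx nxz.
    have [g xg gc] := subsetPn nxc.
    have sg : g \in s :\: z.
      by rewrite inE (subsetP xs) // andbT (contra (subsetP zc g)).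
    exists g => //; apply/esym/group_inj/eqP; rewrite eqEcard cycle_subG xg ox.
    by rewrite -orderE; case: (invs g sg) => ->.
  have [og gc] := invs g sg; have /setDP[gs _] := sg.
  have gG := subsetP sG _ gs.
  have [||||_ _ sx] := @join_branch_neighbour <[g]>%G; rewrite ?cycle_subG //.
    by apply: prime_TIg; rewrite ?cycle_subG // -orderE og.
  have -> : s = (z <*> <[g]>)%G; last by [].
  have oj : #|z <*> <[g]>| = p.*2.
    apply: card_join_branch; rewrite ?cycle_subG //.
    by apply: prime_TIg; rewrite ?cycle_subG // -orderE og.
  by apply/esym/group_inj/eqP; rewrite eqEcard /= oj os leqnn join_subG zs' cycle_subG gs.
rewrite cardsU1 card_in_imset => [|g h sg sh /(congr1 val)/= e].
  rewrite cardsD (setIidPr zs') os oz -addnn addnK.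
  case: imsetP => // - [g sg e]; have /setDP[_] := sg.
  by rewrite e cycle_id.
have [og _] := invs g sg; have [oh _] := invs h sh.
have : g \in <[h]> by rewrite -e cycle_id.
by rewrite cycle2g // => /set2P[g1|//]; rewrite g1 order1 in og.
Qed.

(** A vertex above the reflection group [x] has order [2 p] and contains [z], so
    it equals [z <*> x]. *)
Lemma dihedral_leaf (s x : {group gT}) : s \in neighbours G z -> s != c ->
  x \in neighbours G s -> x != z -> neighbours G x = [set s].
Proof.
move=> zs nsc sx nxz; have [nsc' os sIc] := branchP zs nsc.
have [xs nxc ox xIc] := leafP zs nsc sx nxz.
have px := neighbours_proper sx; have /and3P[xG _ _] := px.
have ps := neighbours_proper zs.
have oj := card_join_branch xG ox xIc.
have join_eq (K : {group gT}) : #|K| = p.*2 -> z \subset K -> x \subset K ->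
    K = (z <*> x)%G.
  move=> oK zK xK; apply/esym/group_inj/eqP.
  by rewrite eqEcard join_subG zK xK oj oK leqnn.
have zs' : z \subset s by rewrite -sIc subsetIl.
apply/setP=> K; rewrite in_set1; apply/idP/eqP=> [xK | ->]; last first.
  exact: neighboursC.
have pK := neighbours_proper xK; have /neighboursP[_ cmp] := xK.
have TI (L : {group gT}) : L \subset c -> L \subset x -> L \subset (1 : {set gT}).
  by move=> Lc Lx; rewrite -xIc subsetI Lx.
have [e|e|[nKc oK KIc]|[nKc oK KIc]] := dihedral_subgroups pK.
- case: cmp => /proper_sub; rewrite e => sub.
    by rewrite (subset_trans sub) in nxc.
  by case/negP: z1; rewrite -subG1 TI.
- case: cmp => /proper_sub; rewrite e => sub; first by rewrite sub in nxc.
  by case/negP: ncz; rewrite (subset_trans (TI _ _ sub)) ?sub1G.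
- by case: cmp => /proper_card; rewrite ox oK.
rewrite (join_eq s) // (join_eq K) -?KIc ?subsetIl //.
case: cmp => [/proper_sub//|/proper_card].
by rewrite oK ox ltnNge -addnn (leq_add (ltnW p_gt1) (ltnW p_gt1)).
Qed.

Lemma dihedral_rooted_tree : rooted_tree G p z c.
Proof.
have cyc_branch g : g \in G -> g \notin c ->
  [/\ <[g]> \subset G, ~~ (<[g]> \subset c), #|<[g]>| = 2 & <[g]> :&: c = 1].
  move=> gG gc; have og : #[g] = 2 by rewrite invol // inE gc.
  rewrite !cycle_subG -orderE; split=> //.
  by apply: prime_TIg; rewrite ?cycle_subG // -orderE og.
split=> //.
- split; last exact: rotations_neighbours.
  by apply/neighboursP; split=> //; left.
- move=> s zs nsc; split; first exact: branch_degree.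
  by move=> x; apply: dihedral_leaf.
- have [g gG gc] : exists2 g, g \in G & g \notin c.
    apply/subsetPn; apply: contraL pc => Gc.
    have -> : c = G by apply/group_inj/eqP; rewrite eqEsubset cG.
    by rewrite /proper_subgroup eqxx !andbF.
  have /cyclicP[a defc] := cyc; have ac : a \in c by rewrite defc cycle_id.
  have agc : a * g \notin c by rewrite groupMl.
  have agG : a * g \in G by rewrite groupM // (subsetP cG).
  have [gS ng og gI] := cyc_branch g gG gc.
  have [agS nag oag agI] := cyc_branch _ agG agc.
  have [zs nsc _] := @join_branch_neighbour <[g]>%G gS ng og gI.
  have [zt ntc _] := @join_branch_neighbour <[a * g]>%G agS nag oag agI.
  (* a child containing both reflections [g] and [a * g] would contain [c] *)
  exists (z <*> <[g]>)%G, (z <*> <[a * g]>)%G => //.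
  have [_ _ sIc] := branchP zs nsc.
  apply: contraNneq ncz => e; rewrite -sIc subsetI subxx andbT.
  have gs : g \in z <*> <[g]> by rewrite -cycle_subG joing_subr.
  have : a * g \in z <*> <[g]>.
    by have /(congr1 val)/= -> := e; rewrite -cycle_subG joing_subr.
  by rewrite groupMr // defc cycle_subG.
move=> H pH; have /and3P[HG _ _] := pH.
have [->|->|[nHc oH HIc]|[nHc oH HIc]] := dihedral_subgroups pH.
- by constructor 1.
- by constructor 2; apply/neighboursP; split=> //; left.
- constructor 3; exists (z <*> H)%G.
    by have [] := join_branch_neighbour HG nHc oH HIc.
  by have [] := join_branch_neighbour HG nHc oH HIc.
constructor 2; apply/neighboursP; split=> //; left.
rewrite properEcard -{1}HIc subsetIl oz oH -addnn.
by rewrite -{1}[p]addn0 ltn_add2l ltnW.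
Qed.
End Root.
End DihedralTree.

Lemma dihedral_reflections (gT : finGroupType) (G : {group gT}) q :
    1 < q -> G \isog 'D_q.*2 ->
  exists c : {group gT}, [/\ cyclic c, #|c| = q, c \subset G
    & {in G :\: c, forall g, #[g] = 2}].
Proof.
move=> q_gt1 isoG.
have [oG /existsP[[a t] /eqP[defG aq t2 at_inv]]] :=
  isoGrpP _ (Grp_dihedral q_gt1) isoG.
rewrite card_dihedral // in oG.
have nat : <[t]> \subset 'N(<[a]>).
  by rewrite cycle_subG inE -cycleJ at_inv cycleV.
have {}defG : <[a]> * <[t]> = G by rewrite -defG norm_joinEr.
have oa_le : #[a] <= q by rewrite dvdn_leq ?(ltnW q_gt1) // order_dvdn aq.
have ot_le : #[t] <= 2 by rewrite dvdn_leq // order_dvdn t2.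
have oa : #[a] = q.
  apply/eqP; rewrite eqn_leq oa_le leqNgt; apply/negP=> lt_aq.
  have : #|G| <= #[a] * #[t] by rewrite -defG mul_cardG leq_pmulr.
  rewrite leqNgt oG -muln2 => /negP[]; apply: leq_ltn_trans (_ : #[a] * 2 < _).
    by rewrite leq_mul2l ot_le orbT.
  by rewrite ltn_mul2r.
exists <[a]>%G; split; rewrite ?cycle_cyclic //.
  by rewrite -defG mulG_subl.
move=> g /setDP[]; rewrite -defG => /mulsgP[u v /= au tv ->{g}] nauv.
have ot : #[t] = 2.
  apply: nt_prime_order => //; apply: contraNneq nauv => t1.
  by move: tv; rewrite t1 cycle1 => /set1P->; rewrite mulg1.
have [v1|vt] : v = 1 \/ v = t by move: tv; rewrite cycle2g // => /set2P.
  by rewrite v1 mulg1 au in nauv.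
apply: nt_prime_order => //; last by apply: contraNneq nauv => ->; apply: group1.
have uV : u ^ t = u^-1.
  by case/cycleP: au => i ->; rewrite conjXg at_inv expgVn.
have tV : t^-1 = t by apply: (mulgI t); rewrite mulgV -t2.
by rewrite vt expg2 -mulgA -{1}tV -conjgE uV mulgV.
Qed.

(** * Groups whose graph is a star *)

Definition star (gT : finGroupType) (G z : {group gT}) : Prop :=
  [/\ proper_subgroup G z,
      {in neighbours G z, forall s, neighbours G s = [set z]},
      forall H, proper_subgroup G H -> H != z -> H \in neighbours G z
    & 1 < #|neighbours G z|].

Lemma star_iso (gT mT : finGroupType) (G : {group gT}) (M : {group mT}) z :
    graph_iso (inclusion_graph G) (inclusion_graph M) ->
  star M z -> exists z', star G z'.
Proof.
case/graph_iso_groups=> k [kI kP kS kN] [pz Ns cov N2].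
exists (k z); split=> [||H|].
- exact: kP.
- move=> H; rewrite kN // => /imsetP[K zK ->{H}].
  by rewrite kN ?(neighbours_proper zK) // Ns // imset_set1.
- case/kS=> K pK -> nKz; rewrite kN // imset_f // cov //.
  by apply: contra_neq nKz => ->.
rewrite kN // card_in_imset // => A B NA NB.
by apply: kI; apply: neighbours_proper; eassumption.
Qed.

Section Star.
Variables (gT : finGroupType) (G z : {group gT}).
Hypothesis S : star G z.

Let pz : proper_subgroup G z. Proof. by case: S. Qed.
Let Ns s : s \in neighbours G z -> neighbours G s = [set z].
Proof. by case: S => _ Ns _ _; apply: Ns. Qed.
Let cov H : proper_subgroup G H -> H != z -> H \in neighbours G z.
Proof. by case: S => _ _ cov _; apply: cov. Qed.
Let two : exists s t, [/\ s \in neighbours G z, t \in neighbours G z & s != t].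
Proof. by case: S => _ _ _ /card_gt1P. Qed.

(** Suppose that the ends are below the centre [z]. An element [g] outside [z]
    then lies in no vertex, so it generates [G]. Two ends [a] and [b] have distinct prime orders, since [G] is
    cyclic; the powers [g ^+ #|a|] and [g ^+ #|b|] generate proper subgroups of
    [G], so they lie in [z], and by Bezout so does [g]. *)
Lemma star_ends_above s : s \in neighbours G z -> z \proper s.
Proof.
move=> zs; have /neighboursP[ps [//|s_lt_z]] := zs.
have below u : u \in neighbours G z -> u \proper z.
  move=> zu; have /neighboursP[pu [z_lt_u|//]] := zu.
  have: u \in neighbours G s.
    by apply/neighboursP; split=> //; left; apply: proper_trans z_lt_u.
  by rewrite Ns // => /set1P uz; rewrite uz properxx in z_lt_u.
have sub_z (H : {group gT}) : proper_subgroup G H -> H \subset z.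
  by move=> pH; have [->//|/(cov pH)/below/proper_sub] := eqVneq H z.
have pr_u u : u \in neighbours G z -> prime #|u|.
  move=> zu; apply: minimal_vertex_prime (neighbours_proper zu) _ => K.
  by rewrite Ns // => /set1P->; rewrite properE (proper_sub (below u zu)) andbF.
have /and3P[zG z1 nzG] := pz.
have [g gG gz] : exists2 g, g \in G & g \notin z.
  by apply/subsetPn; apply: contra nzG => Gz; rewrite eqEsubset zG.
have defG : G :=: <[g]>.
  apply/eqP; rewrite eq_sym; apply: contraNT (gz) => ngG.
  rewrite -cycle_subG (sub_z <[g]>%G) // /proper_subgroup cycle_subG gG ngG andbT.
  by apply: contraNneq gz => e; rewrite -cycle_subG e sub1G.
have gXz u : u \in neighbours G z -> g ^+ #|u| \in z.
  move=> zu; have u_pr := pr_u u zu.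
  have [e1|ne1] := eqVneq <[g ^+ #|u|]> 1; first by rewrite -cycle_subG e1 sub1G.
  rewrite -cycle_subG (sub_z <[_]>%G) // /proper_subgroup cycle_subG groupX //= ne1.
  have u_dvd : #|u| %| #[g].
    by rewrite orderE -defG cardSg //; case/and3P: (neighbours_proper zu).
  have := ltn_Pdiv (prime_gt1 u_pr) (order_gt0 g).
  by rewrite -orderXdiv // !orderE -defG; apply: contraTneq => ->; rewrite ltnn.
have [a [b [za zb nab]]] := two.
have cop : coprime #|a| #|b|.
  rewrite prime_coprime ?pr_u // dvdn_prime2 ?pr_u //.
  have cG : cyclic G by rewrite defG cycle_cyclic.
  have sG u : u \in neighbours G z -> u \subset G.
    by move/neighbours_proper/and3P=> [].
  by rewrite -(eq_subG_cyclic cG) ?sG.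
have [[u v] /= uv] := coprimeP _ (cardG_gt0 a) cop.
have eg : g * g ^+ (#|b| * v) = g ^+ (#|a| * u).
  rewrite -expgS; congr (g ^+ _).
  by rewrite -add1n -uv [(#|b| * v)%N]mulnC [RHS]mulnC subnK // ltnW // -subn_gt0 uv.
by case/negP: gz; rewrite -(groupMr _ (_ : g ^+ (#|b| * v) \in z)) ?eg expgM groupX
  ?gXz.
Qed.

(** [G] is a group of order [q ^ 3] whose only subgroup of order [q] is the
    centre [z] of the star, that is ['Ohm_1(G) = z]. Such a group is cyclic or
    quaternion, and a cyclic group does not have two ends of order [q ^ 2]. *)
Lemma star_quaternion : G \isog 'Q_8.
Proof.
have /and3P[zG z1 nzG] := pz.
have z_pr : prime #|z|.
  apply: minimal_vertex_prime pz _ => K /star_ends_above zK.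
  by rewrite properE (proper_sub zK) andbF.
have sub_z (H : {group gT}) : proper_subgroup G H -> z \subset H.
  by move=> pH; have [->//|/(cov pH)/star_ends_above/proper_sub] := eqVneq H z.
set q := #|z| in z_pr *.
have z_lt_G : #|z| < #|G| by apply: proper_card; rewrite properEneq nzG.
have pG : q.-group G.
  apply/pgroupP=> r r_pr /(Cauchy r_pr)[x xG ox].
  have [e|ne] := eqVneq <[x]> G.
    have : q %| r by rewrite -ox orderE e cardSg.
    by rewrite dvdn_prime2 // inE eq_sym.
  have : q %| r.
    rewrite -ox cardSg // (sub_z <[x]>%G) // /proper_subgroup cycle_subG xG ne andbT.
    by rewrite -cardG_gt1 -orderE ox prime_gt1.
  by rewrite dvdn_prime2 // inE eq_sym.
have ends s : s \in neighbours G z -> cyclic s /\ #|s| = (q ^ 2)%N.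
  move=> zs; have ps := neighbours_proper zs.
  exact: end_vertex_cyclic ps (Ns zs) (star_ends_above zs) z_pr.
have [s [t [zs zt nst]]] := two.
have ps := neighbours_proper zs; have /and3P[sG s1 nsG] := ps.
have oG : #|G| = (q ^ 3)%N.
  rewrite -(Lagrange sG) (p_maximal_index pG).
    by case: (ends s zs) => _ ->; rewrite -expnSr.
  apply/maxgroupP; split; first by rewrite properEneq nsG.
  move=> H /andP[HG nGH] sH; apply: contraNeq nGH => nHs.
  by rewrite (end_vertex_above ps (Ns zs) (star_ends_above zs) sH HG nHs).
have oOhm : #|'Ohm_1(G)| = q.
  suff -> : 'Ohm_1(G) = z by [].
  apply/eqP; rewrite eqEsubset; apply/andP; split.
    rewrite (OhmE 1 pG) gen_subG; apply/subsetP=> x.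
    rewrite !inE expn1 => /andP[xG xq].
    have [->|nx1] := eqVneq x 1; first exact: group1.
    have ox : #[x] = q by apply: nt_prime_order => //; apply/eqP.
    suff zx : z \subset <[x]>.
      have/eqP zE : z :==: <[x]> by rewrite eqEcard zx -orderE ox leqnn.
      by rewrite zE cycle_id.
    apply: (sub_z <[x]>%G); rewrite /proper_subgroup cycle_subG xG cycle_eq1 nx1 /=.
    by apply: contraTneq z_lt_G => <-; rewrite -orderE ox ltnn.
  rewrite (OhmE 1 pG); apply: subset_trans (subset_gen _).
  apply/subsetP=> x zx; rewrite !inE (subsetP zG) //= expn1.
  by rewrite expg_cardG.
have G1 : G :!=: 1 by rewrite -cardG_gt1 (leq_trans _ z_lt_G) // ltnS cardG_gt0.
have /orP[cycG | /andP[/eqP q2 /eqP/quaternion_classP[n n_gt2 isoG]]] :=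
  introT (prime_Ohm1P pG G1) oOhm.
  case/eqP: nst; apply: group_inj; apply/eqP; rewrite (eq_subG_cyclic cycG) //.
    by case: (ends s zs) (ends t zt) => _ -> [_ ->].
  by case/and3P: (neighbours_proper zt).
move: (card_isog isoG); rewrite oG q2 card_quaternion // => /eqP.
by rewrite eqn_exp2l // => /eqP e; rewrite -e in isoG.
Qed.
End Star.

(** The centre is ['Ohm_1(G)], of order 2; it is contained in every nontrivial
    subgroup, and the other vertices have order 4. *)
Lemma quaternion_star (gT : finGroupType) (G : {group gT}) :
  G \isog 'Q_8 -> exists z, star G z.
Proof.
move=> isoG; have oG : #|G| = 8 by rewrite (card_isog isoG) (@card_quaternion 3).
have pG : 2.-group G by rewrite /pgroup oG.
have G1 : G :!=: 1 by rewrite -cardG_gt1 oG.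
have oz : #|'Ohm_1(G)| = 2.
  apply: elimT (prime_Ohm1P pG G1) _; apply/orP; right; apply/eqP.
  by apply/quaternion_classP; exists 3.
have ncyc : ~~ cyclic G.
  have [[x y] gen _] := generators_quaternion (isT : 2 < 3) isoG.
  have [_ [_ _ oder _] _ _ _] := quaternion_structure (isT : 2 < 3) gen isoG.
  apply: contra_eqN oder => /cyclic_abelian/derG1P ->.
  by rewrite cards1.
pose z := 'Ohm_1(G)%G; have zG : z \subset G := Ohm_sub 1 G.
have sub_z (H : {group gT}) : H \subset G -> H :!=: 1 -> z \subset H.
  move=> HG H1; apply: prime_meetG; first by rewrite oz.
  by rewrite setIC; apply: contra H1 => /eqP/TI_Ohm1; rewrite (setIidPl HG) => ->.
have vertex H : proper_subgroup G H -> H != z -> z \subset H /\ #|H| = 4.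
  case/and3P=> HG H1 nHG nHz; have zH := sub_z H HG H1; split=> //.
  have HpG : H \proper G by rewrite properEneq nHG.
  have zpH : z \proper H.
    by rewrite properEneq zH andbT eq_sym; apply: contra_neq nHz => /group_inj.
  have := proper_card HpG; have := proper_card zpH; have := cardSg HG.
  by rewrite oG oz; move: #|H| => n; do 8?[case: n => [|n]].
have pz : proper_subgroup G z.
  rewrite /proper_subgroup zG -cardG_gt1 oz /=.
  by apply: contraTneq isT => e; have := oG; rewrite -e oz.
have cov H : proper_subgroup G H -> H != z -> H \in neighbours G z.
  move=> pH nHz; have [zH oH] := vertex H pH nHz.
  by apply/neighboursP; split=> //; left; rewrite properEcard zH oz oH.
have cyc_vertex g : g \in G -> g \notin z -> proper_subgroup G <[g]>%G && (<[g]>%G != z).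
  move=> gG gz; rewrite /proper_subgroup cycle_subG gG /= -andbA; apply/and3P; split.
  - by apply: contraNneq gz => e; rewrite -cycle_subG e sub1G.
  - by apply: contra ncyc => /eqP <-; apply: cycle_cyclic.
  by apply: contraNneq gz => <-; apply: cycle_id.
exists z; split=> //.
- move=> s zs; have ps := neighbours_proper zs; apply/setP=> K.
  rewrite in_set1; apply/idP/eqP=> [sK | ->]; last exact: neighboursC.
  have pK := neighbours_proper sK.
  have nsz : s != z by apply: contraTneq zs => ->; rewrite inE eqxx /= andbF.
  apply: contraTeq sK => nKz; apply/negP=> /neighboursP[_].
  have [_ os] := vertex s ps nsz; have [_ oK] := vertex K pK nKz.
  by case=> /proper_card; rewrite os oK.
have [g gG gz] : exists2 g, g \in G & g \notin z.
  by apply/subsetPn; apply/negP=> /subset_leq_card; rewrite oG oz.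
have /andP[pg ngz] := cyc_vertex g gG gz; have [zg _] := vertex _ pg ngz.
have [h hG hg] : exists2 h, h \in G & h \notin <[g]>.
  apply/subsetPn; case/and3P: pg => gG' _; apply: contra => Gg.
  by rewrite eqEsubset gG'.
have hz : h \notin z by apply: contra hg; apply: subsetP.
have /andP[ph nhz] := cyc_vertex h hG hz.
apply/card_gt1P; exists <[g]>%G, <[h]>%G; split; rewrite ?cov //.
by apply: contraNneq hg => /(congr1 val)/= ->; apply: cycle_id.
Qed.

(** * The three groups *)

Lemma inclusion_graph_dihedral (gT mT : finGroupType)
    (G : {group gT}) (M : {group mT}) p :
    prime p -> p <= 3 -> M \isog 'D_((p ^ 2).*2) ->
    graph_iso (inclusion_graph G) (inclusion_graph M) ->
  G \isog M.
Proof.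
move=> p_pr p_le3 isoM isoGM.
have p2_gt1 : 1 < p ^ 2 by rewrite -[1%N](expn0 p) ltn_exp2l ?prime_gt1.
have [c [cyc oc cM refl]] := dihedral_reflections p2_gt1 isoM.
have oM : #|M| = (p ^ 2).*2 by rewrite (card_isog isoM) card_dihedral.
have [z [zc oz]] := rotation_root p_pr oc.
have treeM := dihedral_rooted_tree p_pr cyc oc cM oM refl zc oz.
have [z' [c' treeG]] := rooted_tree_iso isoGM treeM.
by rewrite (isog_transr _ isoM) (rooted_tree_dihedral p_pr treeG).
Qed.

Lemma isoGrp_isog (gT rT : finGroupType) (G : {group gT}) (H : {group rT}) p :
  G \isog Grp p -> H \isog Grp p -> G \isog H.
Proof.
move=> isoG isoH; rewrite isogEcard isoH isoGrp_hom //=.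
by apply: leq_homg; rewrite isoG isoGrp_hom.
Qed.

Theorem corollary2p3 (gT : finGroupType) (G : {group gT}) :
  [/\ graph_iso (inclusion_graph G) (inclusion_graph 'Q_8) -> G \isog 'Q_8,
      forall (mT : finGroupType) (M : {group mT}),
        is_M8 M ->
        graph_iso (inclusion_graph G) (inclusion_graph M) -> G \isog M
    & forall (i : nat) (mT : finGroupType) (M : {group mT}),
        has_order2_mod9 i -> is_Z9_rtimes_Z2 i M ->
        graph_iso (inclusion_graph G) (inclusion_graph M) -> G \isog M].
Proof.
split=> [isoGQ | mT M isoM | i mT M i2 isoM].
- have [z starQ] := quaternion_star (isog_refl 'Q_8).
  by have [z' /star_quaternion] := star_iso isoGQ starQ.
- apply: (@inclusion_graph_dihedral _ _ _ _ 2) => //.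
  exact: isoGrp_isog isoM is_M8_dihedral.
apply: (@inclusion_graph_dihedral _ _ _ _ 3) => //.
exact: isoGrp_isog isoM (is_Z9_rtimes_Z2_dihedral i2).
Qed.
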